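(* Let $\mathcal H$ be a finite-dimensional complex Hilbert space, let $\Theta\subseteq\mathbb R$ be an open interval, and let $\theta\mapsto\rho(\theta)$, $\theta\in\Theta$, be a differentiable one-parameter family of states on $\mathcal H$. Suppose that $\rho(\theta)$ is strictly positive for every $\theta\in\Theta$, that the quantum score $\rho_{/\!\!/\theta}(\theta)$ is a smooth function of $\theta$, and that for at least one value of $\theta$ the quantum score $\rho_{/\!\!/\theta}(\theta)$ has distinct eigenvalues (i.e. $\dim\mathcal H$ different eigenvalues). Suppose that there is a measurement $M$ on $\mathcal H$ such that $i(\theta;M)=I(\theta)$ for all $\theta\in\Theta$. Then there is an observable (self-adjoint operator) $X$ on $\mathcal H$ such that the simple measurement $M_X$ of $X$ also satisfies $i(\theta;M_X)=I(\theta)$ for all $\theta\in\Theta$, and the model is of the form $$\rho(\theta)=c(\theta)\exp\{\tfrac12F(X;\theta)\}\,\rho_0\,\exp\{\tfrac12F(X;\theta)\},\qquad\theta\in\Theta,\qquad( * )$$ where $\rho_0$ is a state, $F(\cdot;\theta)$ is, for each $\theta\in\Theta$, a real function on the spectrum of $X$ (differentiable in $\theta$), $c(\theta)=1/\mathrm{tr}\{\rho_0\exp(F(X;\theta))\}$, and, with $f(X;\theta)=\frac{\partial}{\partial\theta}F(X;\theta)$, $$\rho_{/\!\!/\theta}(\theta)=f(X;\theta)-\mathrm{tr}\{\rho(\theta)f(X;\theta)\}\mathbf 1 .$$ Conversely, for any model of this form $( * )$, the simple measurement $M_X$ of $X$ satisfies $i(\theta;M_X)=I(\theta)$ for all $\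theta\in\Theta$.
   Context: A state on $\mathcal H$ is a non-negative self-adjoint operator of trace $1$. A measurement $M$ with outcome space a measurable space $(\mathcal X,\mathcal A)$ is a countably additive map $A\mapsto M(A)$ from $\mathcal A$ into the non-negative self-adjoint operators on $\mathcal H$ with $M(\mathcal X)=\mathbf 1$. Since $\mathcal H$ is finite-dimensional, $M$ has a density $m$ with respect to a $\sigma$-finite measure $\nu$: $M(A)=\int_A m(x)\,\nu(\mathrm dx)$, with $m(x)$ self-adjoint and non-negative. When the state is $\rho(\theta)$, the outcome of $M$ has density $p(x;\theta)=\mathrm{tr}\{\rho(\theta)m(x)\}$ with respect to $\nu$. The simple measurement $M_X$ of an observable $X$ is the projection-valued measure on the (finite) spectrum of $X$ with $M_X(\{x\})=\Pi_{[X=x]}$, the orthogonal projection onto the eigenspace of $X$ for eigenvalue $x$. For a real function $g$ on the spectrum, $g(X)=\sum_x g(x)\Pi_{[X=x]}$; similarly $F(X;\theta)=\sum_xF(x;\theta)\Pi_{[X=x]}$. The quantum score (symmetric logarithmic derivative) $\rho_{/\!\!/\theta}(\theta)$ is the self-adjoint solution of $\frac{\mathrm d}{\mathrm d\theta}\rho(\theta)=\frac12\{\rho(\theta)\rho_{/\!\!/\theta}(\theta)+\rho_{/\!\!/\theta}(\theta)\rho(\theta)\}$ (unique if $\rho(\theta)$ is strictly positive). The quantum information is $I(\theta)=\mathrm{tr}\{\rho(\theta)\rho_{/\!\!/\theta}(\theta)^2\}$ (this does not depend on the choice of solution if there is more than one). The Fisher information in the outcome of $M$ is $$i(\theta;M)=\int_{\{x:p(x;\theta)>0\}}p(x;\theta)^{-1}\left(\Re\,\mathrm{tr}\{\rho(\theta)\rho_{/\!\!/\theta}(\theta)m(x)\}\right)^2\nu(\mathrm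 dx).$$ *)

(* Defs.v *)
From HB Require Import structures.
From mathcomp Require Import all_boot all_order all_algebra.
From mathcomp Require Import complex.
From mathcomp Require Import all_classical all_reals all_analysis.

Set Implicit Arguments.
Unset Strict Implicit.
Unset Printing Implicit Defensive.

Import Order.TTheory GRing.Theory Num.Theory.
Import numFieldNormedType.Exports.

Local Open Scope classical_set_scope.
Local Open Scope ring_scope.
Local Open Scope complex_scope.
Local Open Scope sesquilinear_scope.

(* The Hilbert space is C^(n+1) with C = R[i], so operators are square matrices.
   Dimension 0 is left out because it carries no operator of trace 1. *)
Notation operator R n := 'M[R[i]]_n.+1.
Notation observable R n := (hermitian_matrix n.+1 false (@Num.conj R[i])).

Section operators.
Context {R : realType} {n : nat}.
Implicit Types A X rho : operator R n.

Definition psd A : Prop :=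
  A \is hermsymmx /\ forall v : 'cV[R[i]]_n.+1, 0 <= (v ^t* *m A *m v) 0 0.

Definition posdef A : Prop :=
  A \is hermsymmx /\
  forall v : 'cV[R[i]]_n.+1, v != 0 -> 0 < (v ^t* *m A *m v) 0 0.

Definition is_state rho : Prop := psd rho /\ \tr rho = 1.

Definition spectrum X : set R := [set x | eigenvalue X x%:C].

(* [eigenspace X x] is spanned by rows w with w X = x w.  For Hermitian X these
   are the adjoints of the column eigenvectors, and the orthogonal projection
   onto them is the same matrix as the one onto the column eigenspace. *)
Definition spectral_proj X (x : R) : operator R n :=
  proj_ortho (eigenspace X x%:C).

(* Only the values of g on the spectrum matter. *)
Definition fun_calc (g : R -> R) X : operator R n :=
  \sum_(x \in spectrum X) (g x)%:C *: spectral_proj X x.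

Definition exp_op X : operator R n := fun_calc expR X.

End operators.

Section one_parameter_families.
Context {R : realType} {n : nat}.
Implicit Types A rho : R -> operator R n.

Definition re_entry A (i j : 'I_n.+1) : R -> R := fun t => complex.Re (A t i j).
Definition im_entry A (i j : 'I_n.+1) : R -> R := fun t => complex.Im (A t i j).

Definition op_derivable A (t : R) : Prop :=
  forall i j, derivable (re_entry A i j) t 1 /\ derivable (im_entry A i j) t 1.

Definition op_derive A (t : R) : operator R n :=
  \matrix_(i, j) (derive1 (re_entry A i j) t +i* derive1 (im_entry A i j) t).

Definition op_smooth_on (Theta : set R) A : Prop :=
  forall (k : nat) i j t, Theta t ->
    derivable (derive1n k (re_entry A i j)) t 1 /\
    derivable (derive1n k (im_entry A i j)) t 1.

(* S is a symmetric logarithmic derivative of rho at t. *)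
Definition is_score rho (t : R) (S : operator R n) : Prop :=
  S \is hermsymmx /\ op_derive rho t = 2^-1 *: (rho t *m S + S *m rho t).

End one_parameter_families.

(* The trace of rho S^2 is real for self-adjoint rho and S. *)
Definition quantum_information {R : realType} {n : nat} (rho S : operator R n)
    : R :=
  complex.Re (\tr (rho *m (S *m S))).

Section measurements.
Context {R : realType} {n : nat} {d : measure_display} {T : measurableType d}.
Implicit Types (M : set T -> operator R n) (m : T -> operator R n).

Definition is_measurement M : Prop :=
  [/\ forall A, measurable A -> psd (M A),
      M [set: T] = 1%:M &
      forall F : (set T)^nat,
        (forall k, measurable (F k)) -> trivIset [set: nat] F ->
        forall i j,
          (\sum_(0 <= k < N) complex.Re (M (F k) i j)) @[N --> \oo] -->
            complex.Re (M (\bigcup_k F k) i j) /\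
          (\sum_(0 <= k < N) complex.Im (M (F k) i j)) @[N --> \oo] -->
            complex.Im (M (\bigcup_k F k) i j)].

Definition is_density M (nu : {sigma_finite_measure set T -> \bar R}) m : Prop :=
  [/\ forall x, psd (m x),
      forall i j,
        nu.-integrable [set: T] (fun x => (complex.Re (m x i j))%:E) /\
        nu.-integrable [set: T] (fun x => (complex.Im (m x i j))%:E) &
      forall A, measurable A ->
        M A = \matrix_(i, j) ((\int[nu]_(x in A) complex.Re (m x i j)) +i*
                              (\int[nu]_(x in A) complex.Im (m x i j)))].

(* p(x; theta); the trace is real for self-adjoint rho and m x. *)
Definition outcome_density m (rho : operator R n) (x : T) : R :=
  complex.Re (\tr (rho *m m x)).

Definition fisher_integral (nu : {sigma_finite_measure set T -> \bar R}) m
    (rho S : operator R n) : \bar R :=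
  \int[nu]_(x in [set x | 0 < outcome_density m rho x])
    ((outcome_density m rho x)^-1 *
     complex.Re (\tr (rho *m S *m m x)) ^+ 2)%:E.

(* i(theta; M) = v.  The Fisher integral does not depend on the dominating
   measure and density, so every choice has to give v; the first conjunct makes
   sure that there is one. *)
Definition fisher_information_eq M (rho S : operator R n) (v : \bar R) : Prop :=
  (exists nu m, is_density M nu m) /\
  forall nu m, is_density M nu m -> fisher_integral nu m rho S = v.

End measurements.

Lemma spectrum_nonempty (R : realType) (n : nat) (X : observable R n) :
  exists x : R, x \in spectrum X.
Proof.
have hX : (X : operator R n) \is hermsymmx by case: X.
have rD := hermitian_spectral_diag_real hX.
have /orthomx_spectralP eX := hermitian_normalmx hX.
have uP := spectral_unit X.
set P := spectralmx X in eX uP; set D := spectral_diag X in eX rD.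
have rD0 : D 0 0 \is Num.real by exact: (mxOverP rD).
exists (complex.Re (D 0 0)); rewrite inE /spectrum /=.
have -> : (complex.Re (D 0 0))%:C = D 0 0 by rewrite RRe_real.
apply/eigenvalueP; exists (row 0 P).
  rewrite eX !mulmxA -row_mul mulmxV // row1 -rowE row_diag_mx -scalemxAl.
  by rewrite -rowE.
apply/eqP => P0; have := mulmxV uP => /(congr1 (row 0)).
rewrite row_mul P0 mul0mx => /matrixP/(_ 0 0).
by rewrite !mxE eqxx => /esym/eqP; rewrite oner_eq0.
Qed.

(* The spectrum, as the outcome space of the simple measurement; every subset
   is measurable. *)
Definition outcome (R : realType) (n : nat) (X : observable R n) : Type :=
  spectrum X.

HB.instance Definition _ (R : realType) (n : nat) (X : observable R n) :=
  Choice.on (outcome X).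
HB.instance Definition _ (R : realType) (n : nat) (X : observable R n) :=
  isPointed.Build (outcome X)
    (exist _ (projT1 (cid (spectrum_nonempty X)))
             (projT2 (cid (spectrum_nonempty X)))).
HB.instance Definition _ (R : realType) (n : nat) (X : observable R n) :=
  @isMeasurable.Build default_measure_display (outcome X) discrete_measurable
    discrete_measurable0 discrete_measurableC discrete_measurableU.

Definition simple_measurement (R : realType) (n : nat) (X : observable R n)
    (A : set (outcome X)) : operator R n :=
  \sum_(x \in A) spectral_proj X (val x).

Section exponential_model.
Context {R : realType} {n : nat}.
Implicit Types (X sigma : operator R n) (F : R -> R -> R).

Definition norm_const X sigma F (t : R) : R[i] :=
  (\tr (sigma *m exp_op (fun_calc (F t) X)))^-1.

(* F t x stands for F(x; t). *)
Definition exp_model (Theta : set R) X sigma F (rho : R -> operator R n) : Prop :=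
  [/\ is_state sigma,
      forall t x, Theta t -> spectrum X x -> derivable (fun s => F s x) t 1 &
      forall t, Theta t ->
        rho t = norm_const X sigma F t *:
                  (exp_op (2^-1 *: fun_calc (F t) X) *m sigma *m
                   exp_op (2^-1 *: fun_calc (F t) X))].

Definition param_derive F : R -> R -> R := fun t x => derive1 (fun s => F s x) t.

End exponential_model.

(* Main.v *)
(* Cramer-Rao gap.  With p = tr(rho m), q = Re tr(rho S m) and r = q / p,
     tr(S rho S m) - q^2 / p = tr((S - r) rho (S - r) m) >= 0,
   and integrating the left-hand side gives I(theta) - i(theta; M).  If M
   attains the bound then, rho being positive definite, almost every m(x)
   satisfies S(theta) m(x) = r m(x).  At a theta0 where S has simple spectrum this makes
   m(x) a multiple of the projection onto an eigenvector of S(theta0).  All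
   eigenvectors occur because M has total mass 1, and each of them is an
   eigenvector of every S(theta): so X = S(theta0) works.
     In the eigenbasis of X the equation for the score reads
   rho_ij' = (s_i + s_j) rho_ij / 2.  Its diagonal part gives
   F_i = ln(rho_ii / rho_ii(theta0)) as an antiderivative of s_i, and then
   exp(- (F_i + F_j) / 2) rho_ij is constant.
     Conversely (rho may be singular here), the model has a score L that is a
   function of X.  Any score S has rho S + S rho = rho L + L rho, so
   Re tr(rho S P) = Re tr(rho L P) for every spectral projection P of X, and
   tr(rho S^2) = tr(rho L^2). *)
Require Import Defs.
From HB Require Import structures.
From mathcomp Require Import all_boot all_order all_algebra.
From mathcomp Require Import complex.
From mathcomp Require Import all_classical all_reals all_analysis.
From mathcomp Require Import measurable_realfun.
From mathcomp Require Import ring.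

Set Implicit Arguments.
Unset Strict Implicit.
Unset Printing Implicit Defensive.

Import Order.TTheory GRing.Theory Num.Theory.
Import numFieldNormedType.Exports.

Local Open Scope classical_set_scope.
Local Open Scope ring_scope.
Local Open Scope complex_scope.
Local Open Scope sesquilinear_scope.

(** * Functions of a Hermitian operator *)

Section unitary_diagonalization.
Context {C : numClosedFieldType} {n : nat}.
Implicit Types (A U : 'M[C]_n) (D E : 'rV[C]_n).

Lemma adjM (m p q : nat) (A : 'M[C]_(m, p)) (B : 'M[C]_(p, q)) :
  (A *m B)^t* = B^t* *m A^t*.
Proof. by rewrite trmx_mul map_mxM. Qed.

Lemma herm_adj A : A \is hermsymmx -> A^t* = A.
Proof. by move=> /is_hermitianmxP; rewrite expr0 scale1r => {2}->. Qed.

Lemma adj_herm A : A^t* = A -> A \is hermsymmx.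
Proof. by move=> h; apply/is_hermitianmxP; rewrite expr0 scale1r h. Qed.

Lemma herm_entry A : A \is hermsymmx -> forall i j, A j i = Num.conj (A i j).
Proof. by move=> /herm_adj h i j; rewrite -{1}h !mxE. Qed.

Lemma unitary_adjr U : U \is unitarymx -> U *m U^t* = 1%:M.
Proof. by move/unitarymxP. Qed.

Lemma unitary_adjl U : U \is unitarymx -> U^t* *m U = 1%:M.
Proof. by move=> /unitarymxP/mulmx1C. Qed.

(** The rows of [U] are left eigenvectors, in line with the row convention of [eigenspace]. *)
Definition conj_diag U D : 'M[C]_n := U^t* *m diag_mx D *m U.

Lemma conj_diagM U D E : U \is unitarymx ->
  conj_diag U D *m conj_diag U E = conj_diag U (\row_i (D 0 i * E 0 i)).
Proof.
move=> uU; rewrite /conj_diag !mulmxA -(mulmxA _ U) unitary_adjr // mulmx1.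
by rewrite -(mulmxA (U^t*) (diag_mx _)) mulmx_diag.
Qed.

Lemma conj_diagB U D E : conj_diag U D - conj_diag U E = conj_diag U (D - E).
Proof. by rewrite /conj_diag linearB /= mulmxBr mulmxBl. Qed.

Lemma conj_diagZ U c D : c *: conj_diag U D = conj_diag U (c *: D).
Proof. by rewrite /conj_diag linearZ /= -scalemxAr -scalemxAl. Qed.

Lemma conj_diag_sum U (I : Type) (r : seq I) (P : pred I) (D : I -> 'rV[C]_n) :
  \sum_(k <- r | P k) conj_diag U (D k) = conj_diag U (\sum_(k <- r | P k) D k).
Proof. by rewrite /conj_diag linear_sum /= mulmx_sumr mulmx_suml. Qed.

Lemma conj_diag_const U c : U \is unitarymx -> conj_diag U (const_mx c) = c%:M.
Proof.
move=> uU; rewrite /conj_diag diag_const_mx -mulmxA mul_scalar_mx -scalemxAr.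
by rewrite unitary_adjl // scalemx1.
Qed.

Lemma conj_diag_adj U D : (conj_diag U D)^t* = conj_diag U (map_mx Num.conj D).
Proof. by rewrite /conj_diag !adjM trmxCK mulmxA tr_diag_mx map_diag_mx. Qed.

Lemma conj_diagK U D : U \is unitarymx ->
  U *m conj_diag U D *m U^t* = diag_mx D.
Proof.
move=> uU; rewrite /conj_diag !mulmxA unitary_adjr // mul1mx -mulmxA.
by rewrite unitary_adjr // mulmx1.
Qed.

Lemma gram_diag U D : (diag_mx D *m U)^t* *m (diag_mx D *m U) =
  conj_diag U (\row_i (Num.conj (D 0 i) * D 0 i)).
Proof.
rewrite adjM tr_diag_mx map_diag_mx !mulmxA -(mulmxA _ (diag_mx _)) mulmx_diag.
by congr (_ *m diag_mx _ *m _); apply/rowP => i; rewrite !mxE.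
Qed.

Lemma mul_conj_diagl U D A i j : U \is unitarymx ->
  (U *m (conj_diag U D *m A) *m U^t*) i j = D 0 i * (U *m A *m U^t*) i j.
Proof.
move=> uU; rewrite /conj_diag !mulmxA unitary_adjr // mul1mx -!mulmxA.
by rewrite mul_diag_mx mxE.
Qed.

Lemma mul_conj_diagr U D A i j : U \is unitarymx ->
  (U *m (A *m conj_diag U D) *m U^t*) i j = (U *m A *m U^t*) i j * D 0 j.
Proof.
move=> uU; rewrite /conj_diag !mulmxA -(mulmxA _ U) unitary_adjr // mulmx1.
by rewrite mul_mx_diag mxE.
Qed.

Lemma conj_unitaryK U A : U \is unitarymx -> U^t* *m (U *m A *m U^t*) *m U = A.
Proof.
move=> uU; rewrite !mulmxA unitary_adjl // mul1mx -mulmxA unitary_adjl //.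
exact: mulmx1.
Qed.

Lemma mxtrace_conj_unitary U A :
  U \is unitarymx -> \tr (U *m A *m U^t*) = \tr A.
Proof. by move=> uU; rewrite mxtrace_mulC mulmxA unitary_adjl // mul1mx. Qed.

Lemma mxtrace_adj A : \tr (A^t*) = Num.conj (\tr A).
Proof. by rewrite rmorph_sum; apply: eq_bigr => i _; rewrite !mxE. Qed.

Lemma mxtrace_mul_conj_diag U D A :
  \tr (A *m conj_diag U D) = \sum_i D 0 i * (U *m A *m U^t*) i i.
Proof.
rewrite /conj_diag !mulmxA mxtrace_mulC !mulmxA mul_mx_diag.
by apply: eq_bigr => i _; rewrite mxE mulrC.
Qed.

(** The adjoint of A B E is E B A, and the trace is cyclic. *)
Lemma mxtrace_herm3 (A B E : 'M[C]_n) :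
  A \is hermsymmx -> B \is hermsymmx -> E \is hermsymmx ->
  \tr (B *m A *m E) = Num.conj (\tr (A *m B *m E)).
Proof.
move=> hA hB hE; rewrite -mxtrace_adj !adjM.
by rewrite (herm_adj hA) (herm_adj hB) (herm_adj hE) [in RHS]mxtrace_mulC.
Qed.

Lemma shifted_herm A (r : C) : A \is hermsymmx -> r \is Num.real ->
  (A - r%:M)^t* = A - r%:M.
Proof.
move=> hA hr; rewrite linearB /= map_mxB (herm_adj hA) tr_scalar_mx.
by rewrite map_scalar_mx /= conj_Creal.
Qed.

Lemma mxtrace_shift (S rho A : 'M[C]_n) (r : C) :
  \tr ((S - r%:M) *m rho *m (S - r%:M) *m A) =
  \tr (S *m rho *m S *m A) - r * \tr (S *m rho *m A)
  - (r * \tr (rho *m S *m A) - r * (r * \tr (rho *m A))).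
Proof.
rewrite !mulmxBl !mulmxBr !mulmxBl !mul_scalar_mx !mul_mx_scalar -!scalemxAl.
by rewrite !raddfB /= !mxtraceZ.
Qed.

(** Split 1 as (1 - P) + P. The rows of 1 - P are orthogonal to [E], so the projection kills them;
    the rows of [P] lie in [E], so it fixes them. *)
Lemma proj_ortho_eq (E P : 'M[C]_n) :
  P^t* = P -> (P <= E)%MS -> E *m (1%:M - P) = 0 -> proj_ortho E = P.
Proof.
move=> hP PE EP; have hQ : (1%:M - P)^t* = 1%:M - P.
  by rewrite linearB /= map_mxB hP trmx1 map_mx1.
have QE : (1%:M - P <=
            orthomx (@Num.conj C) (mx_of_hermitian (hermitian1mx _)) E)%MS.
  by apply/orthomx1P; rewrite -[1%:M - P]hQ -adjM EP trmx0 map_mx0.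
rewrite -[LHS]mul1mx -[1%:M](subrK P) mulmxDl.
by rewrite (proj_ortho_0 QE) (proj_ortho_id PE) add0r.
Qed.

End unitary_diagonalization.

(** * Hermitian operators as real diagonals in a unitary basis *)

Section real_diagonal.
Context {R : realType} {n : nat}.
Implicit Types (A U X : operator R n) (d e : 'I_n.+1 -> R).

Lemma observable_herm (X : observable R n) : (X : operator R n) \is hermsymmx.
Proof. by case: X. Qed.

Lemma real_complex_real (x : R) : (x%:C : R[i]) \is Num.real.
Proof. by rewrite complex_real. Qed.

Lemma conj_real_complex (x : R) : Num.conj (x%:C : R[i]) = x%:C.
Proof. exact/CrealP/real_complex_real. Qed.

Lemma half_real_complex : 2^-1 = (2^-1 : R)%:C :> R[i].
Proof. by rewrite fmorphV rmorph_nat. Qed.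

(** For a fixed unitary [U] these form a commutative real algebra that contains all functions of any
    one of its members; functional calculus becomes composition with [d]. *)
Definition in_basis U d : operator R n := conj_diag U (\row_i (d i)%:C).

Lemma spectral_basis X : X \is hermsymmx ->
  exists U d, U \is unitarymx /\ X = in_basis U d.
Proof.
move=> hX; have rD := hermitian_spectral_diag_real hX.
have /orthomx_spectralP eX := hermitian_normalmx hX.
have uP := spectral_unitarymx X; rewrite (invmx_unitary uP) in eX.
exists (spectralmx X), (fun i => complex.Re (spectral_diag X 0 i)); split=> //.
apply: etrans eX _; rewrite -/(conj_diag _ _) /in_basis; congr conj_diag.
by apply/rowP => i; rewrite !mxE RRe_real //; exact: (mxOverP rD).
Qed.

Lemma eq_in_basis U d e : d =1 e -> in_basis U d = in_basis U e.
Proof. by move=> h; congr in_basis; apply/funext. Qed.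

Lemma in_basisB U d e :
  in_basis U d - in_basis U e = in_basis U (fun i => d i - e i).
Proof.
rewrite /in_basis conj_diagB; congr conj_diag.
by apply/rowP => i; rewrite !mxE rmorphB.
Qed.

Lemma in_basisZ U c d : c%:C *: in_basis U d = in_basis U (fun i => c * d i).
Proof.
rewrite /in_basis conj_diagZ; congr conj_diag.
by apply/rowP => i; rewrite !mxE rmorphM.
Qed.

Lemma in_basis_sum U (I : Type) (r : seq I) (P : pred I)
    (d : I -> 'I_n.+1 -> R) :
  \sum_(k <- r | P k) in_basis U (d k) =
  in_basis U (fun i => \sum_(k <- r | P k) d k i).
Proof.
rewrite /in_basis conj_diag_sum; congr conj_diag.
apply/rowP => i; rewrite summxE !mxE rmorph_sum.
by apply: eq_bigr => k _; rewrite mxE.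
Qed.

Lemma in_basis_herm U d : in_basis U d \is hermsymmx.
Proof.
apply: adj_herm; rewrite /in_basis conj_diag_adj; congr conj_diag.
by apply/rowP => i; rewrite !mxE; exact: conj_real_complex.
Qed.

Lemma mxtrace_in_basis A U e :
  \tr (A *m in_basis U e) = \sum_i (e i)%:C * (U *m A *m U^t*) i i.
Proof.
by rewrite mxtrace_mul_conj_diag; apply: eq_bigr => i _; rewrite mxE.
Qed.

Section fixed_basis.
Variable U : operator R n.
Hypothesis uU : U \is unitarymx.

Lemma in_basisM d e :
  in_basis U d *m in_basis U e = in_basis U (fun i => d i * e i).
Proof.
rewrite /in_basis (conj_diagM _ _ uU); congr conj_diag.
by apply/rowP => i; rewrite !mxE rmorphM.
Qed.

Lemma in_basis_cst c : in_basis U (fun=> c) = c%:C%:M.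
Proof.
rewrite -(conj_diag_const _ uU); congr conj_diag.
by apply/rowP => i; rewrite !mxE.
Qed.

Lemma in_basis0 : in_basis U (fun=> 0) = 0.
Proof. by rewrite in_basis_cst -scalemx1 scale0r. Qed.

Lemma in_basisK d i j :
  (U *m in_basis U d *m U^t*) i j = (i == j)%:R * (d i)%:C.
Proof.
rewrite /in_basis (conj_diagK _ uU) !mxE.
by case: (i =P j) => [->|_]; rewrite ?mul1r ?mul0r ?mulr1n ?mulr0n.
Qed.

Lemma in_basis_mull d A i j :
  (U *m (in_basis U d *m A) *m U^t*) i j = (d i)%:C * (U *m A *m U^t*) i j.
Proof. by rewrite (mul_conj_diagl _ _ _ _ uU) mxE. Qed.

Lemma in_basis_mulr d A i j :
  (U *m (A *m in_basis U d) *m U^t*) i j = (U *m A *m U^t*) i j * (d j)%:C.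
Proof. by rewrite (mul_conj_diagr _ _ _ _ uU) [X in _ * X]mxE. Qed.

Lemma conj_basis_inj A B :
  (forall i j, (U *m A *m U^t*) i j = (U *m B *m U^t*) i j) -> A = B.
Proof.
by move=> /matrixP AB; rewrite -(conj_unitaryK A uU) AB conj_unitaryK.
Qed.

(** In an eigenbasis of the score this decouples the score equation into one scalar equation per
    matrix entry. *)
Lemma in_basis_anticomm d A i j :
  (U *m (2^-1 *: (A *m in_basis U d + in_basis U d *m A)) *m U^t*) i j =
  (2^-1 * (d i + d j))%:C * (U *m A *m U^t*) i j.
Proof.
rewrite -scalemxAr -scalemxAl mxE mulmxDr mulmxDl mxE.
rewrite in_basis_mulr in_basis_mull; move: (_ i j) => z.
rewrite rmorphM fmorphV rmorph_nat rmorphD /=; ring.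
Qed.

Lemma spectral_proj_in_basis d x :
  spectral_proj (in_basis U d) x = in_basis U (fun i => (d i == x)%:R).
Proof.
set E := eigenspace (in_basis U d) x%:C.
set Q := in_basis U (fun i => (d i == x)%:R).
have Xx : in_basis U d - x%:C%:M = in_basis U (fun i => d i - x).
  by rewrite -in_basis_cst in_basisB.
have QE : (Q <= E)%MS.
  apply/sub_kermxP; rewrite Xx in_basisM -in_basis0; apply: eq_in_basis => i.
  by case: (d i =P x) => [->|_]; rewrite ?subrr ?mulr0 ?mulr0n ?mul0r.
have EQ : E *m (1%:M - Q) = 0.
  (* Since 0^-1 = 0, the right factor is a pseudo-inverse of X - x; [E] is the kernel of X - x, so
     it kills the product. *)
  have -> : 1%:M - Q = (in_basis U d - x%:C%:M) *m
                        in_basis U (fun i => (d i - x)^-1).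
    rewrite Xx in_basisM -(in_basis_cst 1) in_basisB; apply: eq_in_basis => i.
    case: (d i =P x) => [->|/eqP dx]; first by rewrite !subrr mul0r.
    by rewrite mulr0n subr0 divff ?subr_eq0.
  by rewrite mulmxA mulmx_ker mul0mx.
exact: proj_ortho_eq (herm_adj (in_basis_herm _ _)) QE EQ.
Qed.

Lemma in_basis_eq0 d : in_basis U d = 0 -> forall i, d i = 0.
Proof.
move=> h i; have := in_basisK d i i.
by rewrite h mulmx0 mul0mx mxE eqxx mul1r => /esym[].
Qed.

(** A number is an eigenvalue exactly when its spectral projection is nonzero, and that projection
    is already explicit. *)
Lemma spectrum_in_basis d : spectrum (in_basis U d) = range d.
Proof.
apply/seteqP; split => x /=.
  rewrite /spectrum /= /eigenvalue; apply: contraPP => nd; apply/negP.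
  rewrite negbK -submx0 -proj_orthoE -/(spectral_proj _ x).
  rewrite spectral_proj_in_basis submx0 -in_basis0.
  apply/eqP/eq_in_basis => i; case: (d i =P x) => // h.
  by case: nd; exists i.
case=> i _ <-; rewrite /spectrum /= /eigenvalue -submx0 -proj_orthoE.
rewrite -/(spectral_proj _ _) spectral_proj_in_basis submx0.
by apply/eqP => /in_basis_eq0/(_ i)/eqP; rewrite eqxx oner_eq0.
Qed.

Lemma fun_calc_in_basis g d : fun_calc g (in_basis U d) = in_basis U (g \o d).
Proof.
rewrite /fun_calc spectrum_in_basis.
under eq_fsbigr do rewrite spectral_proj_in_basis in_basisZ.
have ur : uniq (undup (codom d)) by rewrite undup_uniq.
have er : [set` undup (codom d)] = range d.
  apply/seteqP; split => x /=.
    by rewrite mem_undup => /codomP[i ->]; exists i.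
  by case=> i _ <-; rewrite mem_undup codom_f.
rewrite -er -fsbig_seq // in_basis_sum; apply: eq_in_basis => i /=.
(* The sum runs over distinct eigenvalues; at index [i] only the value [d i] contributes. *)
rewrite (bigD1_seq (d i)) ?mem_undup ?codom_f //= eqxx mulr1 big1 ?addr0 // => x.
by rewrite eq_sym => /negbTE ->; rewrite mulr0.
Qed.

Lemma exp_op_in_basis d : exp_op (in_basis U d) = in_basis U (expR \o d).
Proof. exact: fun_calc_in_basis. Qed.

End fixed_basis.
End real_diagonal.

Section complex_parts.
Context {R : realType}.
Implicit Types (x : R) (z w : R[i]).

Lemma cReD z w : complex.Re (z + w) = complex.Re z + complex.Re w.
Proof. by case: z; case: w. Qed.

Lemma cImD z w : complex.Im (z + w) = complex.Im z + complex.Im w.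
Proof. by case: z; case: w. Qed.

Lemma cReN z : complex.Re (- z) = - complex.Re z.
Proof. by case: z. Qed.

Lemma cReM_real x z : complex.Re (x%:C * z) = x * complex.Re z.
Proof. by case: z => a b /=; rewrite mul0r subr0. Qed.

Lemma cImM_real x z : complex.Im (x%:C * z) = x * complex.Im z.
Proof. by case: z => a b /=; rewrite mul0r addr0. Qed.

Lemma cReM z w : complex.Re (z * w) =
  complex.Re z * complex.Re w - complex.Im z * complex.Im w.
Proof. by case: z; case: w. Qed.

Lemma cImM z w : complex.Im (z * w) =
  complex.Re z * complex.Im w + complex.Im z * complex.Re w.
Proof. by case: z; case: w. Qed.

Lemma cRe_conj z : complex.Re (Num.conj z) = complex.Re z.
Proof. by case: z. Qed.

Lemma Re_sum (I : Type) (r : seq I) (P : pred I) (F : I -> R[i]) :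
  complex.Re (\sum_(k <- r | P k) F k) = \sum_(k <- r | P k) complex.Re (F k).
Proof. exact: (big_morph _ cReD). Qed.

Lemma Im_sum (I : Type) (r : seq I) (P : pred I) (F : I -> R[i]) :
  complex.Im (\sum_(k <- r | P k) F k) = \sum_(k <- r | P k) complex.Im (F k).
Proof. exact: (big_morph _ cImD). Qed.

Lemma complex_ext z w :
  complex.Re z = complex.Re w -> complex.Im z = complex.Im w -> z = w.
Proof. by case: z; case: w => ? ? ? ? /= -> ->. Qed.

Lemma Re_ge0 z : 0 <= z -> 0 <= complex.Re z.
Proof. by rewrite lecE => /andP[]. Qed.

Lemma ge0_Re0 z : 0 <= z -> complex.Re z = 0 -> z = 0.
Proof. by rewrite lecE => /andP[/eqP iz _] rz; apply: complex_ext. Qed.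

End complex_parts.

(** * The Cramer-Rao gap *)

Section positivity.
Context {R : realType} {n : nat}.
Implicit Types (A S Y Z rho m : operator R n).

(** Links the quadratic forms in [psd] and [posdef] to the diagonal, hence the trace, of a
    congruence by [Z]. *)
Lemma quadr_row A Z i :
  (Z *m A *m Z^t*) i i =
  (((row i Z)^t*) ^t* *m A *m (row i Z)^t*) 0 0.
Proof.
rewrite trmxCK -row_mul [RHS]mxE [LHS]mxE; apply: eq_bigr => k _.
by rewrite !mxE.
Qed.

Lemma psd_mxtrace_ge0 A Z : psd A -> 0 <= \tr (Z *m A *m Z^t*).
Proof. by case=> _ h; apply: sumr_ge0 => i _; rewrite quadr_row. Qed.

Lemma posdef_psd A : posdef A -> psd A.
Proof.
case=> hA h; split=> // v; have [->|/h/ltW//] := eqVneq v 0.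
by rewrite mulmx0 mxE.
Qed.

Lemma posdef_mxtrace_eq0 A Z : posdef A -> \tr (Z *m A *m Z^t*) = 0 -> Z = 0.
Proof.
move=> pA /eqP; rewrite /mxtrace psumr_eq0; last first.
  by move=> i _; rewrite quadr_row; case: (posdef_psd pA).
move=> /allP h; apply/row_matrixP => i; rewrite row0.
apply/eqP; have /eqP := h i (mem_index_enum i).
rewrite quadr_row; apply: contra_eqT => ri0.
have rA0 : (row i Z)^t* != 0.
  by apply: contra ri0 => /eqP r0; rewrite -[row i Z]trmxCK r0 trmx0 map_mx0.
by case: pA => _ /(_ _ rA0); rewrite lt_neqAle eq_sym => /andP[].
Qed.

Lemma psd_diag_ge0 A Z i : psd A -> 0 <= (Z *m A *m Z^t*) i i.
Proof. by rewrite quadr_row; case. Qed.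

(** Diagonalise and take square roots: the eigenvalues are diagonal entries of a congruence of [A],
    hence nonnegative. *)
Lemma psd_factor A : psd A -> exists Y, A = Y^t* *m Y.
Proof.
move=> pA; have [U [d [uU eA]]] := spectral_basis (proj1 pA).
have d_ge0 i : 0 <= d i.
  have := psd_diag_ge0 U i pA.
  by rewrite eA (in_basisK uU) eqxx mul1r lecR.
exists (diag_mx (\row_i (Num.sqrt (d i))%:C) *m U).
rewrite gram_diag {1}eA /in_basis; congr conj_diag.
apply/rowP => i; rewrite !mxE.
by rewrite [X in X * _]conj_real_complex -rmorphM -expr2 sqr_sqrtr.
Qed.

Lemma Re_mxtrace_swap A B E :
  A \is hermsymmx -> B \is hermsymmx -> E \is hermsymmx ->
  complex.Re (\tr (A *m B *m E)) = complex.Re (\tr (B *m A *m E)).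
Proof. by move=> hA hB hE; rewrite (mxtrace_herm3 hA hB hE) cRe_conj. Qed.

Section gap.
Variables (rho S m : operator R n).
Hypotheses (hrho : psd rho) (hS : S \is hermsymmx) (hm : psd m).

Let p : R := complex.Re (\tr (rho *m m)).
Let q : R := complex.Re (\tr (rho *m S *m m)).
Let h : R := complex.Re (\tr (S *m rho *m S *m m)).

Lemma gap_factor (r : R) Y : m = Y^t* *m Y ->
  \tr (Y *m (S - r%:C%:M) *m rho *m (Y *m (S - r%:C%:M))^t*) =
  \tr ((S - r%:C%:M) *m rho *m (S - r%:C%:M) *m m).
Proof.
move=> ->; rewrite adjM (shifted_herm hS (real_complex_real r)) -!mulmxA.
by rewrite mxtrace_mulC -!mulmxA.
Qed.

Lemma gap_expand (r : R) :
  complex.Re (\tr ((S - r%:C%:M) *m rho *m (S - r%:C%:M) *m m)) =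
  h - 2 * r * q + r ^+ 2 * p.
Proof.
have eSr : complex.Re (\tr (S *m rho *m m)) = q.
  by apply: Re_mxtrace_swap; [|exact: (proj1 hrho)|exact: (proj1 hm)].
rewrite mxtrace_shift /h /p; move: eSr; rewrite /q.
move: (\tr (S *m rho *m S *m m)) (\tr (S *m rho *m m)) => zh zq'.
move: (\tr (rho *m S *m m)) (\tr (rho *m m)) => zq zp eqq.
by rewrite !(cReD, cReN, cReM_real) eqq; ring.
Qed.

(** Stated for every real [r]: the value q / p gives the Cramer-Rao gap, the value 0 gives h >=
    0. *)
Lemma gap_ge0 (r : R) : 0 <= h - 2 * r * q + r ^+ 2 * p.
Proof.
have [Y eY] := psd_factor hm.
by rewrite -gap_expand -(gap_factor _ eY) Re_ge0 // psd_mxtrace_ge0.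
Qed.

Lemma outcome_prob_ge0 : 0 <= p.
Proof.
have [Y eY] := psd_factor hm; rewrite /p eY mulmxA mxtrace_mulC mulmxA.
exact/Re_ge0/psd_mxtrace_ge0.
Qed.

Lemma gap_mxtrace_ge0 : 0 <= h.
Proof. by have := gap_ge0 0; rewrite mulr0 mul0r subr0 expr0n mul0r addr0. Qed.

(** With m = Y^t* Y, definiteness of [rho] forces Y (S - r) = 0; the adjoint relation (S - r) Y^t* =
    0, multiplied by Y, is the claim. *)
Lemma gap_eq0 (r : R) : posdef rho -> h - 2 * r * q + r ^+ 2 * p = 0 ->
  S *m m = r%:C *: m.
Proof.
move=> prho; rewrite -gap_expand; have [Y eY] := psd_factor hm.
rewrite -(gap_factor _ eY) => /ge0_Re0 h0.
have Y0 := posdef_mxtrace_eq0 prho (h0 (psd_mxtrace_ge0 _ hrho)).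
apply/eqP; rewrite -subr_eq0 -mul_scalar_mx -mulmxBl.
rewrite eY mulmxA -(shifted_herm hS (real_complex_real r)) -adjM Y0.
by rewrite trmx0 map_mx0 mul0mx.
Qed.

Lemma outcome_prob_eq0 : posdef rho -> p = 0 -> m = 0.
Proof.
move=> prho; have [Y eY] := psd_factor hm; rewrite /p eY mulmxA mxtrace_mulC.
rewrite mulmxA => /ge0_Re0 h0.
have Y0 := posdef_mxtrace_eq0 prho (h0 (psd_mxtrace_ge0 _ hrho)).
by rewrite Y0 mulmx0.
Qed.

End gap.
End positivity.

(** * Exponential models *)

Section complex_derivatives.
Context {R : realType}.
Implicit Types (f g : R -> R[i]) (t : R) (z w c : R[i]).

Definition cderive f t z : Prop :=
  is_derive t 1 (fun s => complex.Re (f s)) (complex.Re z) /\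
  is_derive t 1 (fun s => complex.Im (f s)) (complex.Im z).

Lemma cderiveM_cst c f t z :
  cderive f t z -> cderive (fun s => c * f s) t (c * z).
Proof.
move=> [rf mf]; split.
  under eq_fun do rewrite cReM; rewrite cReM.
  exact: is_deriveB (is_deriveZ _ rf) (is_deriveZ _ mf).
under eq_fun do rewrite cImM; rewrite cImM.
exact: is_deriveD (is_deriveZ _ mf) (is_deriveZ _ rf).
Qed.

Lemma cderive_sum k (f : 'I_k -> R -> R[i]) t (z : 'I_k -> R[i]) :
  (forall i, cderive (f i) t (z i)) ->
  cderive (fun s => \sum_i f i s) t (\sum_i z i).
Proof.
move=> df; split.
  under eq_fun do rewrite Re_sum; rewrite Re_sum -fct_sumE.
  by apply: is_derive_sum => i; case: (df i).
under eq_fun do rewrite Im_sum; rewrite Im_sum -fct_sumE.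
by apply: is_derive_sum => i; case: (df i).
Qed.

Lemma cderiveZ (a : R -> R) (a' : R) f t z : is_derive t 1 a a' ->
  cderive f t z ->
  cderive (fun s => (a s)%:C * f s) t ((a t)%:C * z + a'%:C * f t).
Proof.
move=> da [rf mf]; split.
  under eq_fun do rewrite cReM_real; rewrite cReD !cReM_real.
  by rewrite (mulrC a'); exact: is_deriveM.
under eq_fun do rewrite cImM_real; rewrite cImD !cImM_real.
by rewrite (mulrC a'); exact: is_deriveM.
Qed.

Lemma cderive_cst c t : cderive (fun=> c) t 0.
Proof. by split; exact: is_derive_cst. Qed.

(** Derivatives are local, so formulas known only on the open set [Theta] may be differentiated
    there. *)
Lemma near_cderive f g t z :
  (\near t, f t = g t) -> cderive f t z -> cderive g t z.
Proof.
by move=> fg [rf mf]; split;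
  [apply: near_eq_is_derive rf|apply: near_eq_is_derive mf];
  apply: filterS fg => s ->.
Qed.

Context {n : nat}.
Implicit Types (A : R -> operator R n) (B P Q : operator R n).

Definition mderive A t B : Prop :=
  forall i j, cderive (fun s => A s i j) t (B i j).

Lemma mderive_op_derive A t B : mderive A t B -> op_derive A t = B.
Proof.
move=> dA; apply/matrixP => i j; rewrite mxE !derive1E.
have [dr di] := dA i j.
rewrite (@derive_val _ _ _ _ _ _ _ dr) (@derive_val _ _ _ _ _ _ _ di).
by case: (B i j).
Qed.

Lemma op_derivable_mderive A t :
  op_derivable A t -> mderive A t (op_derive A t).
Proof.
move=> dA i j; have [dr di] := dA i j; rewrite mxE !derive1E.
by split; exact: derivableP.
Qed.

Lemma mderive_mul A t B P Q : mderive A t B ->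
  mderive (fun s => P *m A s *m Q) t (P *m B *m Q).
Proof.
move=> dA i j; rewrite !mxE; under eq_fun do rewrite mxE.
apply: cderive_sum => k; under eq_fun do rewrite mulrC; rewrite mulrC.
apply: cderiveM_cst; rewrite mxE; under eq_fun do rewrite mxE.
by apply: cderive_sum => l; apply: cderiveM_cst.
Qed.

End complex_derivatives.

Lemma psd_conj {R : realType} {n : nat} (A Z : operator R n) :
  psd A -> psd (Z *m A *m Z^t*).
Proof.
move=> [hA A0]; split.
  by apply: adj_herm; rewrite !adjM trmxCK (herm_adj hA) mulmxA.
by move=> v; have := A0 (Z^t* *m v); rewrite adjM trmxCK !mulmxA.
Qed.

Lemma psd_scale {R : realType} {n : nat} (A : operator R n) (c : R) :
  0 <= c -> psd A -> psd (c%:C *: A).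
Proof.
move=> c0 [hA A0]; split.
  apply: adj_herm; apply/matrixP => i j; rewrite !mxE rmorphM.
  by congr (_ * _); [exact: conj_real_complex | exact: esym (herm_entry hA j i)].
move=> v; rewrite -scalemxAr -scalemxAl mxE mulr_ge0 ?lecR //.
Qed.

Section exponential_models.
Context {R : realType} {n : nat}.
Variables (Theta : set R) (X sigma : operator R n) (F : R -> R -> R).
Variable rho : R -> operator R n.
Hypotheses (hX : X \is hermsymmx) (Theta_open : open Theta).
Hypothesis model : exp_model Theta X sigma F rho.

(** In an eigenbasis of [X] the normalising constant is the real number 1 / Z, where Z is the sum of
    exp(F) over the eigenvalues, weighted by the diagonal of [sigma]. *)
Lemma exp_model_basis : exists U d (c : R -> R),
  [/\ U \is unitarymx, X = in_basis U d,
      forall t, Theta t -> 0 < c t /\ exists c', is_derive t 1 c c' &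
      forall t, Theta t -> rho t = (c t)%:C *:
        (in_basis U (fun i => expR (2^-1 * F t (d i))) *m sigma *m
         in_basis U (fun i => expR (2^-1 * F t (d i))))].
Proof.
have [[psig tsig] dF erho] := model.
have [U [d [uU eX]]] := spectral_basis hX.
have half t : exp_op (2^-1 *: fun_calc (F t) X) =
              in_basis U (fun i => expR (2^-1 * F t (d i))).
  rewrite eX (fun_calc_in_basis uU) half_real_complex.
  by rewrite in_basisZ; exact: (exp_op_in_basis uU).
pose w i := complex.Re ((U *m sigma *m U^t*) i i).
have wE i : (U *m sigma *m U^t*) i i = (w i)%:C.
  by rewrite /w RRe_real // ger0_real // psd_diag_ge0.
have w_ge0 i : 0 <= w i by rewrite -lecR -wE psd_diag_ge0.
have sum_w : \sum_i w i = 1.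
  apply: (@complexI R); rewrite rmorph_sum rmorph1 -tsig.
  rewrite -(mxtrace_conj_unitary sigma uU).
  by apply: eq_bigr => i _; rewrite wE.
pose Z t := \sum_i w i * expR (F t (d i)).
(* The nonnegative weights sum to 1, so one of them is positive, and its term alone makes [Z]
   positive. *)
have Z_gt0 t : 0 < Z t.
  have [|i /andP[_ wi]] := @psumr_neq0P _ _ predT w (fun i _ => w_ge0 i).
    by rewrite sum_w; exact/eqP/oner_neq0.
  rewrite /Z (bigD1 i) //= ltr_pwDl ?mulr_gt0 ?expR_gt0 //.
  by apply: sumr_ge0 => j _; rewrite mulr_ge0 ?expR_ge0.
exists U, d, (fun t => (Z t)^-1); split=> //.
  move=> t Tt; split; first by rewrite invr_gt0.
  have /choice[f df] i : exists f, is_derive t 1 (fun s => F s (d i)) f.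
    eexists; apply/derivableP/dF => //.
    by rewrite eX (spectrum_in_basis uU); exists i.
  have dZ i : is_derive t 1 (fun s => w i * expR (F s (d i)))
                  (w i *: (expR (F t (d i)) * f i)).
    exact: is_deriveZ (is_derive1_comp (is_derive_expR _) (df i)).
  eexists; apply: is_deriveV; first exact: lt0r_neq0.
  by rewrite /Z -fct_sumE; exact: is_derive_sum dZ.
move=> t Tt; rewrite erho // half; congr (_ *: _).
rewrite /norm_const eX (fun_calc_in_basis uU) (exp_op_in_basis uU) fmorphV.
congr (_^-1); rewrite mxtrace_in_basis rmorph_sum.
by apply: eq_bigr => i _; rewrite mulrC rmorphM wE.
Qed.

Lemma exp_model_psd t : Theta t -> psd (rho t).
Proof.
have [U [d [c [uU _ dc erho]]]] := exp_model_basis.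
move=> Tt; rewrite erho //; apply: psd_scale; first by have [/ltW] := dc _ Tt.
set K := in_basis _ _; have eK : K^t* = K by exact/herm_adj/in_basis_herm.
rewrite -{2}eK.
by apply: psd_conj; case: model => -[].
Qed.

Lemma exp_model_score t : Theta t -> exists g,
  op_derive rho t = 2^-1 *: (rho t *m fun_calc g X + fun_calc g X *m rho t).
Proof.
have [U [d [c [uU eX dc erho]]]] := exp_model_basis.
move=> Tt; have [ct [c' dct]] := dc _ Tt.
(* Entry (i, j) of rho is a constant times c e_i e_j. The logarithmic derivative c' / c + (f_i +
   f_j) / 2 of this factor is the mean of f + c' / c over the two indices, as in
   [in_basis_anticomm]. *)
exists (fun x => param_derive F t x + c' / c t); apply: mderive_op_derive.
rewrite eX (fun_calc_in_basis uU); set l := _ \o d; set B := 2^-1 *: _.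
pose e i s := expR (2^-1 * F s (d i)).
have de i : is_derive t 1 (e i) (2^-1 * param_derive F t (d i) * e i t).
  rewrite mulrC; apply: is_derive1_comp.
  apply: (@is_deriveZ _ _ _ _ 2^-1); rewrite /param_derive derive1E.
  apply/derivableP; case: model => _ dF _; apply: dF => //.
  by rewrite eX (spectrum_in_basis uU); exists i.
suff dU : mderive (fun s => U *m rho s *m U^t*) t (U *m B *m U^t*).
  have := mderive_mul (U^t*) U dU; rewrite (conj_unitaryK _ uU).
  by rewrite (funext (fun s => conj_unitaryK (rho s) uU)).
have rhoE s i j : Theta s -> (U *m rho s *m U^t*) i j =
    (c s * e i s * e j s)%:C * (U *m sigma *m U^t*) i j.
  move=> Ts; rewrite erho // -scalemxAr -scalemxAl mxE (in_basis_mulr uU).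
  by rewrite (in_basis_mull uU) !rmorphM /=; ring.
move=> i j; rewrite (in_basis_anticomm uU) (rhoE t i j Tt).
apply: (@near_cderive _ (fun s => (c s * e i s * e j s)%:C *
                                    (U *m sigma *m U^t*) i j)).
  have : \near t, Theta t by exact: open_nbhs_nbhs.
  by apply: filterS => s Ts; rewrite rhoE.
have dE : is_derive t 1 (fun s => c s * e i s * e j s)
    (2^-1 * (l i + l j) * (c t * e i t * e j t)).
  apply: is_derive_eq (is_deriveM (is_deriveM dct (de i)) (de j)) _.
  rewrite /l /= /GRing.scale /=.
  have c0 := lt0r_neq0 ct.
  by rewrite (_ : (c * e i) t = c t * e i t) //; field.
have := cderiveZ dE (cderive_cst ((U *m sigma *m U^t*) i j) t).
by rewrite mulr0 add0r mulrA -rmorphM.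
Qed.

End exponential_models.

(** * Simple measurements *)

Lemma set_filter_full (T : choiceType) (s : seq T) (A : set T) :
  (forall x, x \in s) -> [set` [seq x <- s | x \in A]] = A.
Proof.
move=> s_full; apply/seteqP; split=> x /=.
  by rewrite mem_filter => /andP[/set_mem].
by move=> Ax; rewrite mem_filter s_full andbT mem_set.
Qed.

Lemma fsbig_full (V : nmodType) (T : choiceType) (s : seq T) (A : set T)
    (f : T -> V) :
  uniq s -> (forall x, x \in s) ->
  \sum_(x \in A) f x = \sum_(x <- s | x \in A) f x.
Proof.
by move=> us s_full; rewrite -[in LHS](set_filter_full A s_full) -fsbig_seq
  ?filter_uniq // big_filter.
Qed.

(** * Integrals over a finite discrete space *)

Section discrete_integral.
Context {R : realType} {d : measure_display} {T : measurableType d}.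
Variables (mu : {measure set T -> \bar R}) (s : seq T).
Hypotheses (mT : forall A : set T, measurable A) (us : uniq s).
Hypothesis s_full : forall x, x \in s.

Lemma discrete_measurable_fun d' (U : sigmaRingType d') (D : set T)
    (f : T -> U) :
  measurable_fun D f.
Proof. by move=> _ B _; exact: mT. Qed.

Lemma integral_discrete (A : set T) (f : T -> R) :
  (\int[mu]_(x in A) (f x)%:E =
   \sum_(x <- s | x \in A) (f x)%:E * mu [set x])%E.
Proof.
(* Cut the domain into singletons, on each of which the integrand is constant. *)
have eA : A = \big[setU/set0]_(x <- [seq x <- s | x \in A]) [set x].
  by rewrite -bigcup_seq bigcup_imset1 image_id set_filter_full.
rewrite {1}eA integral_bigsetU_EFin ?filter_uniq //.
- rewrite big_filter; apply: eq_bigr => x _.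
  rewrite (eq_integral (cst (f x)%:E)) => [|y]; last by rewrite inE => ->.
  by rewrite integral_cst.
- by move=> x y _ _ [z [-> ->]].
Qed.

Lemma integrable_discrete (f : T -> R) : (forall x, mu [set x] < +oo)%E ->
  mu.-integrable [set: T] (EFin \o f).
Proof.
move=> fin; apply/integrableP; split; first exact: discrete_measurable_fun.
rewrite (integral_discrete _ (fun x => `|f x|)); apply: lte_sum_pinfty => x _.
by apply: lte_mul_pinfty => //; rewrite lee_fin.
Qed.

Lemma Rintegral_set1 (x : T) (f : T -> R) :
  \int[mu]_(y in [set x]) f y = f x * fine (mu [set x]).
Proof.
rewrite (@eq_Rintegral _ _ _ _ _ (fun=> f x)) ?Rintegral_cst //.
by move=> y; rewrite inE => ->.
Qed.

End discrete_integral.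

Section simple_measurements.
Context {R : realType} {n : nat}.
Variable X : observable R n.
Let hX := observable_herm X.

(** One enumeration serves sums over the spectrum, sums over sets of outcomes and integrals over
    outcomes alike. *)
Lemma outcome_enum : exists s : seq (outcome X),
  [/\ uniq s, forall x, x \in s & spectrum X = [set` map val s]].
Proof.
have [U [d [uU eX]]] := spectral_basis hX.
have fX : finite_set (spectrum X).
  by rewrite eX (spectrum_in_basis uU); exact: finite_image.
have fT : finite_set [set: outcome X].
  by rewrite (eq_finite_set (card_setT (spectrum X))).
pose s := finmap.enum_fset (fset_set [set: outcome X]).
have sT x : x \in s by rewrite in_fset_set // inE.
exists s; split; [exact: finmap.fset_uniq | exact: sT |].
apply/seteqP; split=> [x xX|x /mapP[y _ ->]].
  by apply/mapP; exists (exist _ x (mem_set xX)).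
exact: set_mem (valP y).
Qed.

Lemma psd1 : psd (1%:M : operator R n).
Proof.
split; first by apply: adj_herm; rewrite trmx1 map_mx1.
move=> v; rewrite mulmx1 mxE; apply: sumr_ge0 => i _.
by rewrite !mxE mulrC mul_conjC_ge0.
Qed.

Lemma spectral_proj_psd x : psd (spectral_proj X x).
Proof.
have [U [d [uU ->]]] := spectral_basis hX.
rewrite (spectral_proj_in_basis uU); set Q := in_basis _ _.
suff -> : Q = Q *m 1%:M *m Q^t* by exact/psd_conj/psd1.
rewrite mulmx1 herm_adj ?in_basis_herm // (in_basisM uU).
apply: eq_in_basis => i.
by case: eqP; rewrite ?mulr1 ?mulr0.
Qed.

Lemma spectral_proj_neq0 x : spectrum X x -> spectral_proj X x != 0.
Proof.
have [U [d [uU eX]]] := spectral_basis hX.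
rewrite eX (spectrum_in_basis uU) => -[i _ <-]; apply/eqP.
rewrite (spectral_proj_in_basis uU) => /(in_basis_eq0 uU)/(_ i)/eqP.
by rewrite eqxx oner_eq0.
Qed.

Lemma fun_calc_spectral_proj g x :
  fun_calc g X *m spectral_proj X x = (g x)%:C *: spectral_proj X x.
Proof.
have [U [d [uU ->]]] := spectral_basis hX.
rewrite (spectral_proj_in_basis uU) (fun_calc_in_basis uU) (in_basisM uU).
rewrite in_basisZ.
apply: eq_in_basis => i /=.
by case: (d i =P x) => [->|_]; rewrite ?mulr1 ?mulr0.
Qed.

Lemma spectral_proj_fun_calc g x :
  spectral_proj X x *m fun_calc g X = (g x)%:C *: spectral_proj X x.
Proof.
rewrite -fun_calc_spectral_proj; have [U [d [uU ->]]] := spectral_basis hX.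
rewrite (spectral_proj_in_basis uU) (fun_calc_in_basis uU).
apply: etrans (in_basisM uU _ _) (etrans _ (esym (in_basisM uU _ _))).
by apply: eq_in_basis => i; rewrite mulrC.
Qed.

Lemma fun_calc_sqr g :
  fun_calc g X *m fun_calc g X = fun_calc (fun x => g x ^+ 2) X.
Proof.
have [U [d [uU ->]]] := spectral_basis hX.
by rewrite !(fun_calc_in_basis uU) in_basisM.
Qed.

End simple_measurements.

Section simple_measurement_information.
Context {R : realType} {n : nat}.
Variable X : observable R n.

Let hX := observable_herm X.
Let mX (A : set (outcome X)) : measurable A. Proof. by []. Qed.

Lemma finite_outcomes (A : set (outcome X)) : finite_set A.
Proof.
have [s [_ sT _]] := outcome_enum X.
apply: (@sub_finite_set _ _ [set` s]) => [x _|]; first exact: sT.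
exact: finite_seq.
Qed.

(* A copy of [counting], whose sigma-finiteness instance is tied to [nat]. *)
Definition outcome_count : set (outcome X) -> \bar R := counting.

HB.instance Definition _ := Measure.copy outcome_count (@counting (outcome X) R).

Lemma sigma_finite_outcomes : sigma_finite [set: outcome X] outcome_count.
Proof.
exists (fun=> setT) => [|_]; first by rewrite bigcup_const.
split=> //; rewrite /outcome_count /counting asboolT ?ltry //.
exact: finite_outcomes.
Qed.

HB.instance Definition _ := @Measure_isSigmaFinite.Build _ _ _
  outcome_count sigma_finite_outcomes.

Lemma outcome_count_set1 (x : outcome X) : outcome_count [set x] = 1%E.
Proof.
by rewrite /outcome_count /counting asboolT // fset_set1 finmap.cardfs1.
Qed.

Lemma simple_measurement_density :
  is_density (@simple_measurement R n X) outcome_count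
    (fun x => spectral_proj X (val x)).
Proof.
have [s [us sT _]] := outcome_enum X.
have intf (f : outcome X -> R) A :
    \int[outcome_count]_(x in A) f x = \sum_(x <- s | x \in A) f x.
  rewrite /Rintegral (integral_discrete _ mX us sT).
  under eq_bigr do rewrite [X in (_ * X)%E]outcome_count_set1 mule1.
  by rewrite sumEFin.
split=> [x|i j|A _]; first exact: spectral_proj_psd.
  by split; apply: (integrable_discrete mX us sT) => x;
    rewrite [X in (X < _)%E]outcome_count_set1 ltry.
apply/matrixP => i j; rewrite mxE !intf /simple_measurement.
rewrite (fsbig_full _ _ us sT).
by rewrite summxE; apply: complex_ext; rewrite ?Re_sum ?Im_sum.
Qed.

Section attained.
Variables (rho S : operator R n) (g : R -> R).
Hypotheses (prho : psd rho) (hS : S \is hermsymmx).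
Hypothesis rhoS : rho *m S + S *m rho =
  rho *m fun_calc g X + fun_calc g X *m rho.

Let L := fun_calc g X.

(** The left-hand side is half of Re tr((rho S + S rho) Pi). By [rhoS] the anticommutator can be
    taken with g(X) instead, and g(X) acts on Pi from either side as the scalar [g x]. *)
Lemma Re_score_proj x : complex.Re (\tr (rho *m S *m spectral_proj X x)) =
  g x * complex.Re (\tr (rho *m spectral_proj X x)).
Proof.
set Pi := spectral_proj X x.
have [hPi _] : psd Pi := spectral_proj_psd X x.
have eS : complex.Re (\tr (S *m rho *m Pi)) = complex.Re (\tr (rho *m S *m Pi)).
  exact: Re_mxtrace_swap hS (proj1 prho) (proj1 (spectral_proj_psd X x)).
have : complex.Re (\tr ((rho *m S + S *m rho) *m Pi)) =
       g x * complex.Re (\tr (rho *m Pi)) *+ 2.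
  rewrite rhoS mulmxDl mxtraceD cReD -mulmxA fun_calc_spectral_proj.
  rewrite -(mulmxA (fun_calc g X)) [X in _ + complex.Re X]mxtrace_mulC.
  rewrite -(mulmxA rho).
  rewrite spectral_proj_fun_calc -scalemxAr mxtraceZ cReM_real.
  by rewrite mulr2n.
rewrite mulmxDl mxtraceD cReD eS -mulr2n => /eqP.
by rewrite eqrMn2r => /eqP.
Qed.

Lemma quantum_information_score : quantum_information rho S =
  complex.Re (\tr (rho *m (L *m L))).
Proof.
(* [H] is symmetric and sees its first argument only through the anticommutator with [rho]; hence H
   S S = H L S = H S L = H L L. *)
pose H A B := \tr ((rho *m A + A *m rho) *m B) : R[i].
have HE A B : H A B = \tr (rho *m A *m B) + \tr (rho *m B *m A).
  rewrite /H mulmxDl mxtraceD; congr (_ + _).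
  by rewrite -mulmxA mxtrace_mulC.
have e : H S S = H L L.
  have -> : H S S = H L S by rewrite /H rhoS.
  by rewrite HE addrC -HE /H rhoS.
have twice A : H A A = \tr (rho *m (A *m A)) *+ 2 by rewrite HE mulmxA mulr2n.
rewrite /quantum_information; congr complex.Re.
by move: e; rewrite !twice; apply: pmulrnI.
Qed.

Lemma simple_measurement_attains :
  fisher_information_eq (@simple_measurement R n X) rho S
    (quantum_information rho S)%:E.
Proof.
split.
  by exists outcome_count; eexists; exact: simple_measurement_density.
move=> nu m [pm _ eM]; have [s [us sT sX]] := outcome_enum X.
pose v x := fine (nu [set x]).
(* Evaluating the measurement on a singleton determines any density up to the weight [v x]. *)
have eP x : spectral_proj X (val x) = (v x)%:C *: m x.
  transitivity (@simple_measurement R n X [set x]).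
    by rewrite /simple_measurement fsbig_set1.
  rewrite eM //; apply/matrixP => i j; rewrite !mxE !Rintegral_set1 //.
  by apply: complex_ext; rewrite ?cReM_real ?cImM_real /= mulrC.
have v_neq0 x : v x != 0.
  apply/eqP => v0; have /negP[] := spectral_proj_neq0 (set_mem (valP x)).
  by rewrite eP v0 scale0r.
(* [fine] sends infinite values to 0, so [v_neq0] also excludes an infinite mass. *)
have nuE x : nu [set x] = (v x)%:E.
  rewrite fineK //; move: (v_neq0 x); rewrite /v; case: (nu [set x]) => //.
    by rewrite eqxx.
  by rewrite eqxx.
rewrite /fisher_integral (integral_discrete _ mX us sT).
under eq_bigr do rewrite [X in (_ * X)%E]nuE -EFinM.
rewrite sumEFin quantum_information_score fun_calc_sqr; congr (_%:E).
rewrite /fun_calc sX -fsbig_seq ?(map_inj_uniq val_inj) // big_map.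
rewrite mulmx_sumr [\tr _]raddf_sum Re_sum big_mkcond /=; apply: eq_bigr => x _.
have := Re_score_proj (val x).
rewrite -scalemxAr mxtraceZ cReM_real eP -!scalemxAr !mxtraceZ !cReM_real.
rewrite -/(outcome_density m rho x); set p := outcome_density m rho x.
set q := complex.Re _ => eq_q.
have {}eq_q : q = g (val x) * p.
  by apply: (mulfI (v_neq0 x)); rewrite eq_q mulrCA.
have p_ge0 : 0 <= p by exact: outcome_prob_ge0.
case: ifPn => [|]; first rewrite inE /= -/p => p_gt0.
  by rewrite -/p eq_q; field; exact: lt0r_neq0.
(* Outcomes of probability 0 lie outside the domain of integration, and they add 0 to tr(rho L^2)
   too. *)
rewrite notin_setE /= -/p => /negP; rewrite -leNgt => p_le0.
by have -> : p = 0 by [apply/le_anti; rewrite p_ge0 p_le0]; rewrite !mulr0.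
Qed.

End attained.
End simple_measurement_information.

(** * Measurements attaining the bound *)

Section integral_values.
Context {R : realType} {d : measure_display} {T : measurableType d}.
Variable mu : {measure set T -> \bar R}.

(** Integrability and value are bundled so that both pass through linear combinations together. *)
Definition has_integral (f : T -> R) (v : R) : Prop :=
  mu.-integrable [set: T] (EFin \o f) /\ (\int[mu]_x (f x)%:E = v%:E)%E.

Lemma has_integralD f g v w : has_integral f v -> has_integral g w ->
  has_integral (fun x => f x + g x) (v + w).
Proof.
move=> [intf ef] [intg eg]; split.
  exact: (integrableD measurableT intf intg).
under eq_integral do rewrite EFinD.
rewrite (@integralD_EFin _ _ _ _ _ _ f g) // [X in (X + _)%E]ef.
by rewrite [X in (_ + X)%E]eg.
Qed.

Lemma has_integralZ (c : R) f v :
  has_integral f v -> has_integral (fun x => c * f x) (c * v).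
Proof.
move=> [intf ef]; split; first exact: (integrableZl measurableT c intf).
under eq_integral do rewrite EFinM.
by rewrite (@integralZl _ _ _ _ _ _ (EFin \o f)) // [X in (_ * X)%E]ef.
Qed.

Lemma has_integral_sum k (f : 'I_k -> T -> R) (v : 'I_k -> R) :
  (forall i, has_integral (f i) (v i)) ->
  has_integral (fun x => \sum_i f i x) (\sum_i v i).
Proof.
elim: k f v => [|k IH] f v fv.
  rewrite big_ord0 (_ : (fun _ => _) = cst 0); last first.
    by apply/funext => x; rewrite big_ord0.
  by split; [exact: integrable0 | exact: integral0].
rewrite big_ord_recl (_ : (fun _ => _) =
    fun x => f ord0 x + \sum_(i < k) f (lift ord0 i) x); last first.
  by apply/funext => x; rewrite big_ord_recl.
by apply: has_integralD => //; exact: IH.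
Qed.

Lemma has_integral_measurable f v : has_integral f v -> measurable_fun setT f.
Proof. by case=> /measurable_int/measurable_EFinP. Qed.

End integral_values.

Section density.
Context {R : realType} {n : nat} {d : measure_display} {T : measurableType d}.
Variable M : set T -> operator R n.
Variable nu : {sigma_finite_measure set T -> \bar R}.
Variable m : T -> operator R n.
Hypotheses (MT : M setT = 1%:M) (dm : is_density M nu m).

Lemma has_integral_entry i j :
  has_integral nu (fun x => complex.Re (m x i j))
    (complex.Re ((1%:M : operator R n) i j)) /\
  has_integral nu (fun x => complex.Im (m x i j))
    (complex.Im ((1%:M : operator R n) i j)).
Proof.
have [_ im eM] := dm; have [ir ii] := im i j.
have e : (1%:M : operator R n) i j =
    (\int[nu]_x complex.Re (m x i j)) +i* (\int[nu]_x complex.Im (m x i j)).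
  by rewrite -MT eM // mxE.
split; split => //; rewrite e /= /Rintegral fineK //; exact: integrable_fin_num.
Qed.

(** The density integrates to M(T) = 1 and the real part of the trace is real-linear in its entries.
    With [B] = S rho S the value is the quantum information. *)
Lemma has_integral_mxtrace (B : operator R n) :
  has_integral nu (fun x => complex.Re (\tr (B *m m x))) (complex.Re (\tr B)).
Proof.
have trE (A : operator R n) : complex.Re (\tr (B *m A)) =
    \sum_i \sum_j (complex.Re (B i j) * complex.Re (A j i) +
                   - complex.Im (B i j) * complex.Im (A j i)).
  rewrite Re_sum; apply: eq_bigr => i _; rewrite mxE Re_sum.
  by apply: eq_bigr => j _; rewrite cReM mulNr.
rewrite -[in complex.Re _](mulmx1 B) trE.
under eq_fun do rewrite trE.
apply: has_integral_sum => i; apply: has_integral_sum => j.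
have [hr hi] := has_integral_entry j i.
by apply: has_integralD; exact: has_integralZ.
Qed.

Section optimal.
Variables rho S : operator R n.
Hypotheses (prho : posdef rho) (hS : S \is hermsymmx).
Hypothesis optimal :
  fisher_integral nu m rho S = (quantum_information rho S)%:E.

Let p x : R := complex.Re (\tr (rho *m m x)).
Let q x : R := complex.Re (\tr (rho *m S *m m x)).
Let h x : R := complex.Re (\tr (S *m rho *m S *m m x)).

Let pm x : psd (m x). Proof. by case: dm. Qed.

Let p_ge0 x : 0 <= p x.
Proof. exact: outcome_prob_ge0 (posdef_psd prho) (pm x). Qed.

Let p_eq0 x : p x = 0 -> m x = 0.
Proof. exact: outcome_prob_eq0 (posdef_psd prho) (pm x) prho. Qed.

(** The ratio q / p minimises h - 2 r q + r^2 p over r, and the minimum is the Cramer-Rao gap. *)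
Let gapE x : p x != 0 ->
  h x - (p x)^-1 * q x ^+ 2 =
  h x - 2 * (q x / p x) * q x + (q x / p x) ^+ 2 * p x.
Proof. by move=> px; field. Qed.

Let gap_nonneg x : (p x)^-1 * q x ^+ 2 <= h x.
Proof.
have [px|px] := eqVneq (p x) 0.
  (* Here the left-hand side is 0 because 0^-1 = 0. *)
  by rewrite px invr0 mul0r; exact: gap_mxtrace_ge0 (posdef_psd prho) hS (pm x).
rewrite -subr_ge0 gapE //.
exact: gap_ge0 (posdef_psd prho) hS (pm x) _.
Qed.

Lemma optimal_ae_eigen :
  {ae nu, forall x, exists r : R, S *m m x = r%:C *: m x}.
Proof.
have [inth eh] := has_integral_mxtrace (S *m rho *m S).
have mp := has_integral_measurable (has_integral_mxtrace rho).
have mq := has_integral_measurable (has_integral_mxtrace (rho *m S)).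
(* Where [p x = 0], [m x = 0] and [(p x)^-1 = 0]: [f] vanishes there and its
   integral over the whole space is the Fisher integral. *)
pose f x := (p x)^-1 * q x ^+ 2.
have f_ge0 x : 0 <= f x by rewrite mulr_ge0 ?invr_ge0 ?sqr_ge0.
have mf : measurable_fun setT f.
  apply: measurable_funM.
    (* On nonnegative reals, 0 included, the inverse is the power -1, and real powers are
       measurable. *)
    rewrite (_ : (fun _ => _) = fun x => p x `^ (-1)); last first.
      by apply/funext => x; rewrite powR_inv1.
    exact: (measurableT_comp (measurable_powR (-1)) mp).
  exact: (measurable_funX 2 mq).
have intf : nu.-integrable setT (EFin \o f).
  apply: le_integrable inth => //; first exact/measurable_EFinP.
  move=> x _; rewrite /= lee_fin (ger0_norm (f_ge0 x)).
  exact: le_trans (gap_nonneg x) (ler_norm _).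
have ef : (\int[nu]_x (f x)%:E = (complex.Re (\tr (S *m rho *m S)))%:E)%E.
  rewrite -mulmxA mxtrace_mulC -mulmxA -/(quantum_information rho S) -optimal.
  rewrite /fisher_integral [RHS]integral_mkcond; apply: eq_integral => x _.
  rewrite patchE; case: ifPn => //; rewrite notin_setE /= => /negP.
  rewrite -leNgt => px_le0.
  have px : p x = 0 by apply/le_anti; rewrite p_ge0 px_le0.
  by rewrite /f px invr0 mul0r.
(* Both [h] and [f] integrate to the quantum information, so the nonnegative gap has integral 0 and
   vanishes almost everywhere. *)
have := integralB_EFin measurableT inth intf.
rewrite [X in (X - _)%E]eh ef -EFinB subrr => int0.
pose gap x := h x - f x.
have mgap : measurable_fun setT (EFin \o gap).
  apply/measurable_EFinP; apply: measurable_funB => //.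
  exact: has_integral_measurable (has_integral_mxtrace _).
have /(ae_eq_integral_abs nu measurableT mgap).1 :
    (\int[nu]_x `|(EFin \o gap) x|)%E = 0%E.
  apply: etrans int0; apply: eq_integral => x _ /=.
  by rewrite ger0_norm ?EFinB // subr_ge0 gap_nonneg.
apply: filterS => x /(_ I) /= [hf].
have [px|px] := eqVneq (p x) 0.
  (* Where [p] vanishes so does [m], and any eigenvalue will do. *)
  by exists 0; rewrite (p_eq0 px) mulmx0 scaler0.
exists (q x / p x).
apply: (gap_eq0 (posdef_psd prho) hS (pm x) prho).
exact: etrans (esym (gapE px)) hf.
Qed.

End optimal.
End density.

(** * A basis that diagonalises every score *)

Section common_eigenbasis.
Context {R : realType} {n : nat} {d : measure_display} {T : measurableType d}.
Variable M : set T -> operator R n.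
Variable nu : {sigma_finite_measure set T -> \bar R}.
Variable m : T -> operator R n.
Hypotheses (MT : M setT = 1%:M) (dm : is_density M nu m).
Variables (U : operator R n) (e : 'I_n.+1 -> R).
Hypotheses (uU : U \is unitarymx) (e_inj : injective e).
Hypothesis eigen0 :
  {ae nu, forall x, exists r : R, in_basis U e *m m x = r%:C *: m x}.

(** The i-th diagonal entry of the density has integral 1; it cannot vanish wherever [P] holds, as
    its integral would then be 0. *)
Lemma ae_exists_diag (P : T -> Prop) i : {ae nu, forall x, P x} ->
  exists2 x, P x & (U *m m x *m U^t*) i i != 0.
Proof.
move=> aeP; apply: contrapT => noX.
(* The projection onto the i-th basis vector turns the diagonal entry into a trace. *)
pose B := in_basis U (fun k => (k == i)%:R).
have trB (A : operator R n) : \tr (B *m A) = (U *m A *m U^t*) i i.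
  rewrite mxtrace_mulC mxtrace_in_basis (bigD1 i) //= eqxx mul1r big1 ?addr0 //.
  by move=> k /negbTE ->; rewrite mul0r.
have [intB eB] := has_integral_mxtrace MT dm B.
have : (\int[nu]_x (complex.Re (\tr (B *m m x)))%:E = \int[nu]_x (cst 0 x))%E.
  apply: ae_eq_integral => //; first exact: measurable_int intB.
  apply: filterS aeP => x Px _ /=; rewrite trB.
  have [->//|mx] := eqVneq ((U *m m x *m U^t*) i i) 0.
  by case: noX; exists x.
rewrite eB integral0 -[B]mulmx1 trB mulmx1 (unitary_adjr uU) mxE eqxx => -[].
by move/eqP; rewrite oner_eq0.
Qed.

(** For each i, pick a point where both eigenvalue relations hold and m has a nonzero i-th diagonal
    entry. The first relation leaves only row i of m; the second then reads off column i of [S]. *)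
Lemma common_eigenbasis (S : operator R n) :
  {ae nu, forall x, exists r : R, S *m m x = r%:C *: m x} ->
  exists s, S = in_basis U s.
Proof.
move=> eigen.
suff /choice[s Ss] : forall i, exists r : R, forall k,
    (U *m S *m U^t*) k i = (k == i)%:R * r%:C.
  exists s; apply: (conj_basis_inj uU) => k i; rewrite Ss (in_basisK uU).
  by case: (k =P i) => [->|] //; rewrite !mul0r.
move=> i; have [x [[r0 S0m] [r Sm]] mii] :
    exists2 x, (exists r : R, in_basis U e *m m x = r%:C *: m x) /\
               (exists r : R, S *m m x = r%:C *: m x) &
               (U *m m x *m U^t*) i i != 0.
  by apply: ae_exists_diag; apply: filterS2 eigen0 eigen.
set mh := U *m m x *m U^t* in mii.
have d_mh k l : (e k)%:C * mh k l = r0%:C * mh k l.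
  by rewrite -(in_basis_mull uU) S0m -scalemxAr -scalemxAl mxE.
have ei : e i = r0 by apply: (@complexI R); apply: (mulIf mii).
(* A nonzero entry in row k would give e k = r0 = e i, against injectivity. *)
have mh0 k l : k != i -> mh k l = 0.
  move=> ki; apply/eqP; have /eqP := d_mh k l.
  rewrite -subr_eq0 -mulrBl mulf_eq0 subr_eq0 => /orP[/eqP /complexI ek|//].
  by case/eqP: ki; apply: e_inj; rewrite ek ei.
exists r => k; apply: (mulIf mii).
have : ((U *m S *m U^t*) *m mh) k i = r%:C * mh k i.
  rewrite /mh !mulmxA -(mulmxA _ (U^t*) U) (unitary_adjl uU) mulmx1.
  by rewrite -(mulmxA U) Sm -scalemxAr -scalemxAl mxE.
(* Only row i of [mh] survives, so the product entry is S_ki times [mh i i]. *)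
rewrite mxE (bigD1 i) //= big1 ?addr0; last first.
  by move=> l li; rewrite mh0 // mulr0.
move=> ->; case: (k =P i) => [->|/eqP ki]; first by rewrite mul1r.
by rewrite mh0 // mulr0 !mul0r.
Qed.

End common_eigenbasis.

(** The list [codom e] has n + 1 terms; if n + 1 remain after removing duplicates, there were
    none. *)
Lemma card_spectrum_inj {R : realType} {n : nat} (U : operator R n) e :
  U \is unitarymx -> (spectrum (in_basis U e) #= `I_n.+1)%card -> injective e.
Proof.
move=> uU; rewrite (spectrum_in_basis uU) => /card_fset_set sz.
apply/injectiveP; rewrite /injectiveb /dinjectiveb -/(codom e).
have fr : finite_set (range e) by exact: finite_image.
have : size (undup (codom e)) = n.+1.
  apply: etrans sz; apply/perm_size/uniq_perm.
  - exact: undup_uniq.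
  - exact: finmap.fset_uniq.
  move=> x; rewrite mem_undup in_fset_set //; apply/codomP/idP => [[i ->]|].
    by rewrite inE; exists i.
  by rewrite inE => -[i _ <-]; exists i.
apply: contra_eqT; rewrite -ltn_size_undup size_codom card_ord => lt.
by rewrite neq_ltn lt.
Qed.

Lemma derive0_interval_cst {R : realType} (Theta : set R) (f : R -> R) :
  is_interval Theta -> (forall t, Theta t -> is_derive t 1 f 0) ->
  forall t u, Theta t -> Theta u -> f t = f u.
Proof.
move=> iT df t u; wlog tu : t u / t <= u.
  move=> hw Tt Tu; case: (leP t u) => [tu|/ltW ut]; first exact: hw.
  exact/esym/hw.
move=> Tt Tu.
have T_tu x : x \in `[t, u] -> Theta x by rewrite in_itv /=; exact: iT.
have [||c _] := @MVT_segment R f (fun=> 0) t u tu.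
- by move=> x xtu; apply/df/T_tu/subset_itv_oo_cc.
- by apply: derivable_within_continuous => x /T_tu/df[].
by rewrite mul0r => /eqP; rewrite subr_eq0 => /eqP.
Qed.

Lemma mderive_mxtrace {R : realType} {n : nat} (A : R -> operator R n) t B :
  mderive A t B -> cderive (fun s => \tr (A s)) t (\tr B).
Proof. by move=> dA; apply: cderive_sum => i; exact: dA. Qed.

Lemma cderive_unique {R : realType} (f : R -> R[i]) t z w :
  cderive f t z -> cderive f t w -> z = w.
Proof.
move=> [rz iz] [rw iw]; apply: complex_ext.
  by rewrite -(@derive_val _ _ _ _ _ _ _ rz) (@derive_val _ _ _ _ _ _ _ rw).
by rewrite -(@derive_val _ _ _ _ _ _ _ iz) (@derive_val _ _ _ _ _ _ _ iw).
Qed.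

(** * Reconstruction of the model *)

(** Serves both directions: it is the converse, and it also gives attainment once the direct part
    has produced the model. The given score and the function of [X] from [exp_model_score] have the
    same anticommutator with rho(t). *)
Lemma exp_model_attains (R : realType) (n : nat) (Theta : set R)
    (X : observable R n) (sigma : operator R n) (F : R -> R -> R)
    (rho : R -> operator R n) (t : R) (S : operator R n) :
  open Theta -> exp_model Theta X sigma F rho -> Theta t -> is_score rho t S ->
  fisher_information_eq (@simple_measurement R n X) (rho t) S
    (quantum_information (rho t) S)%:E.
Proof.
move=> oT model Tt [hS eS].
have hX := observable_herm X.
have [g eg] := exp_model_score hX oT model Tt.
apply: (simple_measurement_attains (g := g) (exp_model_psd hX model Tt) hS).
have two_neq0 : (2^-1 : R[i]) != 0 by rewrite invr_eq0 pnatr_eq0.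
by apply: (scalerI two_neq0); rewrite -eS.
Qed.

Section reconstruction.
Context {R : realType} {n : nat}.
Variables (Theta : set R) (rho score : R -> operator R n) (t0 : R).
Variables (U : operator R n) (s : R -> 'I_n.+1 -> R).
Hypotheses (Theta_open : open Theta) (Theta_itv : is_interval Theta).
Hypothesis state : forall t, Theta t -> is_state (rho t).
Hypothesis diff : forall t, Theta t -> op_derivable rho t.
Hypothesis pos : forall t, Theta t -> posdef (rho t).
Hypothesis sld : forall t, Theta t -> is_score rho t (score t).
Hypotheses (T0 : Theta t0) (uU : U \is unitarymx) (s_inj : injective (s t0)).
Hypothesis scoreE : forall t, Theta t -> score t = in_basis U (s t).

Let r t : operator R n := U *m rho t *m U^t*.
Let a i t : R := complex.Re (r t i i).
(** The antiderivative of the i-th score eigenvalue that vanishes at [t0], in closed form from the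
    diagonal of rho; it becomes F at the i-th eigenvalue of X. *)
Let G i t : R := ln (a i t) - ln (a i t0).
Let e i t : R := expR (2^-1 * G i t).

Lemma unitary_row_neq0 i : row i U != 0.
Proof.
apply/eqP => r0; have := congr1 (row i) (unitary_adjr uU).
rewrite row_mul r0 mul0mx => /rowP/(_ i)/eqP.
by rewrite !mxE eqxx eq_sym oner_eq0.
Qed.

Let rE t i : Theta t -> r t i i = (a i t)%:C.
Proof.
move=> Tt; rewrite /a RRe_real // ger0_real //.
exact/psd_diag_ge0/posdef_psd/pos.
Qed.

Let a_gt0 t i : Theta t -> 0 < a i t.
Proof.
move=> Tt; rewrite -ltcR -rE // /r quadr_row.
have [_ p] := pos Tt; apply: p.
apply: contra (unitary_row_neq0 i) => /eqP r0.
by rewrite -[row i U]trmxCK r0 trmx0 map_mx0.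
Qed.

Let dr t i j : Theta t ->
  cderive (fun u => r u i j) t ((2^-1 * (s t i + s t j))%:C * r t i j).
Proof.
move=> Tt; have := mderive_mul U (U^t*) (op_derivable_mderive (diff Tt)).
have [_ ->] := sld Tt; rewrite scoreE // => /(_ i j).
by rewrite (in_basis_anticomm uU).
Qed.

Let dG t i : Theta t -> is_derive t 1 (G i) (s t i).
Proof.
move=> Tt; have [da _] := dr i i Tt.
have := is_derive1_comp (is_derive1_ln (a_gt0 i Tt)) da.
move=> dln; have dG : is_derive t 1 (G i) _ :=
  is_deriveB dln (is_derive_cst (ln (a i t0)) t 1).
apply: (is_derive_eq dG); rewrite subr0 cReM_real -/(a i t).
by field; exact/lt0r_neq0/a_gt0.
Qed.

(** [w] is an integrating factor for the scalar equation [dr]: the product w r_ij has derivative 0,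
    so it equals its value at [t0], where G vanishes. *)
Let rhoE t i j : Theta t -> r t i j = (e i t * e j t)%:C * r t0 i j.
Proof.
move=> Tt; pose w u := expR (- (2^-1 * (G i u + G j u))).
have dw u : Theta u -> cderive (fun v => (w v)%:C * r v i j) u 0.
  move=> Tu; pose c := 2^-1 * (s u i + s u j).
  have dw : is_derive u 1 w (- c * w u).
    rewrite mulrC; apply: is_derive1_comp (is_derive_expR _) _.
    exact: is_deriveN (is_deriveZ 2^-1 (is_deriveD (dG i Tu) (dG j Tu))).
  suff <- : (w u)%:C * (c%:C * r u i j) + (- c * w u)%:C * r u i j = 0.
    exact: cderiveZ dw (dr i j Tu).
  by move: (r u i j) (w u) (c) => z v k; rewrite mulNr rmorphN rmorphM /=; ring.
have cw : (w t)%:C * r t i j = (w t0)%:C * r t0 i j.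
  apply: complex_ext.
    exact: (derive0_interval_cst Theta_itv (fun u Tu => proj1 (dw u Tu)) Tt T0).
  exact: (derive0_interval_cst Theta_itv (fun u Tu => proj2 (dw u Tu)) Tt T0).
have G0 k : G k t0 = 0 by rewrite /G subrr.
move: cw; rewrite {2}/w !G0 addr0 mulr0 oppr0 expR0 mul1r => <-.
rewrite mulrA -rmorphM /w /e -!expRD -mulrDr.
by rewrite addrC addNr expR0 mul1r.
Qed.

(** F has to depend on the eigenvalue rather than on the index; injectivity of [s t0] makes the
    lookup unambiguous. Off the spectrum F defaults to 0. *)
Let idx x : option 'I_n.+1 := [pick i | s t0 i == x].
Let F t x : R := if idx x is Some i then G i t else 0.

Let FE i t : F t (s t0 i) = G i t.
Proof.
rewrite /F /idx; case: pickP => [j /eqP/s_inj -> //|/(_ i)].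
by rewrite eqxx.
Qed.

Let F_calc t : fun_calc (F t) (score t0) = in_basis U (G^~ t).
Proof.
rewrite scoreE // (fun_calc_in_basis uU).
by apply: eq_in_basis => i /=; rewrite FE.
Qed.

(** Multiplying the diagonal of rho(t0) by exp(G) gives the diagonal of rho(t), so the trace being
    inverted is tr rho(t) = 1. *)
Let norm1 t : Theta t -> norm_const (score t0) (rho t0) F t = 1.
Proof.
move=> Tt; rewrite /norm_const F_calc (exp_op_in_basis uU) mxtrace_in_basis.
rewrite -[RHS]invr1; congr (_^-1); have [_ <-] := state Tt.
rewrite -(mxtrace_conj_unitary (rho t) uU); apply: eq_bigr => i _.
have -> : (expR \o G^~ t) i = e i t * e i t.
  by rewrite /e -expRD /=; congr expR; field.
exact/esym/rhoE.
Qed.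

Lemma reconstruct_model : exists F : R -> R -> R,
  exp_model Theta (score t0) (rho t0) F rho /\
  forall t, Theta t -> score t = fun_calc (param_derive F t) (score t0) -
    (\tr (rho t *m fun_calc (param_derive F t) (score t0)))%:M.
Proof.
exists F; split.
  split=> [|t x Tt|t Tt]; first exact: state.
    rewrite scoreE // (spectrum_in_basis uU) => -[i _ <-].
    by under eq_fun do rewrite FE; case: (dG i Tt).
  rewrite norm1 // scale1r F_calc half_real_complex.
  rewrite in_basisZ (exp_op_in_basis uU).
  apply: (conj_basis_inj uU) => i j.
  rewrite (in_basis_mulr uU) (in_basis_mull uU) -/(r t) rhoE //.
  by rewrite rmorphM /=; ring.
move=> t Tt.
(* For this F the operator f(X; t) is the score itself, so it remains to see that its mean is 0. *)
have -> : fun_calc (param_derive F t) (score t0) = score t.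
  rewrite [in LHS]scoreE // (fun_calc_in_basis uU) scoreE //.
  apply: eq_in_basis => i /=; rewrite /param_derive derive1E.
  under eq_fun do rewrite FE.
  exact: (@derive_val _ _ _ _ _ _ _ (dG i Tt)).
(* Differentiate tr rho = 1: the trace of the score equation is tr(rho score). *)
suff -> : \tr (rho t *m score t) = 0 by rewrite -scalemx1 scale0r subr0.
have dtr := mderive_mxtrace (op_derivable_mderive (diff Tt)).
have /cderive_unique/(_ dtr) : cderive (fun u => \tr (rho u)) t 0.
  apply: (@near_cderive _ (fun=> 1)); last exact: cderive_cst.
  have : \near t, Theta t by exact: open_nbhs_nbhs.
  by apply: filterS => u /state[_ ->].
have [_ ->] := sld Tt; rewrite mxtraceZ mxtraceD.
rewrite [\tr (score t *m _)]mxtrace_mulC.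
rewrite -mulr2n -[X in _ * X]mulr_natl mulrA mulVf ?pnatr_eq0 // mul1r => <-.
by [].
Qed.

End reconstruction.

Theorem theorem2 (R : realType) (n : nat) (Theta : set R)
    (Theta_open : open Theta) (Theta_itv : is_interval Theta) :
  (forall (rho score : R -> operator R n),
     (forall t, Theta t -> is_state (rho t)) ->
     (forall t, Theta t -> op_derivable rho t) ->
     (forall t, Theta t -> posdef (rho t)) ->
     (forall t, Theta t -> is_score rho t (score t)) ->
     op_smooth_on Theta score ->
     (exists2 t, Theta t & (spectrum (score t) #= `I_n.+1)%card) ->
     forall (d : measure_display) (T : measurableType d)
       (M : set T -> operator R n)
       (nu : {sigma_finite_measure set T -> \bar R}) (m : T -> operator R n),
     is_measurement M ->
     is_density M nu m ->
     (forall t, Theta t ->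
        fisher_integral nu m (rho t) (score t) =
        (quantum_information (rho t) (score t))%:E) ->
     exists X : observable R n,
       (forall t, Theta t ->
          fisher_information_eq (@simple_measurement R n X) (rho t) (score t)
            (quantum_information (rho t) (score t))%:E) /\
       exists (rho0 : operator R n) (F : R -> R -> R),
         exp_model Theta X rho0 F rho /\
         forall t, Theta t ->
           score t = fun_calc (param_derive F t) X -
                     (\tr (rho t *m fun_calc (param_derive F t) X))%:M)
  /\
  (forall (X : observable R n) (rho0 : operator R n) (F : R -> R -> R)
     (rho score : R -> operator R n),
     exp_model Theta X rho0 F rho ->
     (forall t, Theta t -> is_score rho t (score t)) ->
     forall t, Theta t ->
       fisher_information_eq (@simple_measurement R n X) (rho t) (score t)
         (quantum_information (rho t) (score t))%:E).
Proof.
split; last first.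
  move=> X rho0 F rho score model sld t Tt.
  by apply: (exp_model_attains Theta_open model Tt); exact: sld.
move=> rho score state diff pos sld _ [t0 T0 card0] d T M nu m [_ MT _] dm opt.
have eigen t (Tt : Theta t) :=
  optimal_ae_eigen MT dm (pos t Tt) (proj1 (sld t Tt)) (opt t Tt).
have [U [e [uU eS]]] := spectral_basis (proj1 (sld t0 T0)).
have e_inj : injective e by apply: (card_spectrum_inj uU); rewrite -eS.
have /choice[s0 scoreE] t : exists s, Theta t -> score t = in_basis U s.
  (* A dummy value outside [Theta] lets choice give a function on all of R. *)
  have [Tt|nT] := pselect (Theta t); last by exists (fun=> 0).
  have := eigen t0 T0; rewrite eS => eigen0.
  have [s st] := common_eigenbasis MT dm uU e_inj eigen0 (eigen t Tt).
  by exists s.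
(* [s0] comes from choice, so its value at [t0] is not known to be [e]; the eigenvalue count is
   applied again. *)
have s_inj : injective (s0 t0).
  by apply: (card_spectrum_inj uU); rewrite -scoreE.
have [F [model eF]] :=
  reconstruct_model Theta_open Theta_itv state diff pos sld T0 uU s_inj scoreE.
(* The observable is the score at the parameter where its spectrum is simple. *)
pose X : observable R n := HermitianMx (proj1 (sld t0 T0)).
have modelX : exp_model Theta X (rho t0) F rho := model.
exists X; split; last by exists (rho t0), F.
by move=> t Tt; exact: exp_model_attains Theta_open modelX Tt (sld t Tt).
Qed.
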